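(* Let $R$ be a commutative Noetherian ring and let $V$ be a finitely generated FI-module over $R$. Then there exists some $N\ge 0$ such that for all $n\in\mathbb{N}$ $$V_n=\operatorname*{colim}_{S\subset[n],\ |S|\le N} V_S,$$ that is, the natural map from the colimit to $V_n$ is an isomorphism.
   Context: Let $\mathrm{FI}$ be the category whose objects are finite sets and whose morphisms are injections; $[n]=\{1,\dots,n\}$, $[0]=\emptyset$. For a commutative ring $R$, an FI-module over $R$ is a covariant functor $V$ from $\mathrm{FI}$ to the category of $R$-modules; write $V_S=V(S)$, $V_n=V([n])$, and $f_*=V(f)$ for an injection $f$. A sub-FI-module $W\subset V$ is a collection of $R$-submodules $W_S\subset V_S$, one for each finite set $S$, with $f_*(W_S)\subset W_T$ for every injection $f\colon S\to T$. An FI-module $V$ is finitely generated if there is a finite subset of $\coprod_{n\ge 0}V_n$ that is not contained in any proper sub-FI-module of $V$. The colimit is taken in $R$-modules over the poset of subsets $S\subset[n]$ with $|S|\le N$, ordered by inclusion, with transition maps induced by the inclusions $S\subset S'$; the natural map to $V_n$ is induced by the inclusions $S\hookrightarrow[n]$. *)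

(* Defs.v *)
From HB Require Import structures.
From mathcomp Require Import all_boot all_order all_algebra.
From mathcomp Require Import boolp.

Set Implicit Arguments.
Unset Strict Implicit.
Unset Printing Implicit Defensive.

Import GRing.Theory.
Local Open Scope ring_scope.
Local Open Scope quotient_scope.

Definition is_submodule (R : pzRingType) (M : lmodType R) (W : M -> Prop) :=
  W 0 /\ forall (a : R) (u v : M), W u -> W v -> W (a *: u + v).

Definition generated (R : pzRingType) (M : lmodType R) (X : M -> Prop) (m : M) :=
  forall W : M -> Prop, is_submodule W -> (forall x, X x -> W x) -> W m.

(* The ideals of [R] are the submodules of the regular module [R^o]. *)
Definition noetherian (R : comPzRingType) :=
  forall I : R^o -> Prop, is_submodule I ->
    exists s : seq R^o, forall x, I x <-> generated (fun y => y \in s) x.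

(* The value [fi_map f injf] does not depend on the proof [injf], and depends   *)
(* only on the values of [f], by proof irrelevance and functional               *)
(* extensionality.                                                              *)
Record fi_module (R : comPzRingType) := FIModule {
  fi_obj :> finType -> lmodType R;
  fi_map : forall (S T : finType) (f : S -> T), injective f ->
    {linear fi_obj S -> fi_obj T};
  fi_map_id : forall (S : finType) (inj_id : injective (@id S)) (v : fi_obj S),
    fi_map inj_id v = v;
  fi_map_comp : forall (S T U : finType) (f : S -> T) (g : T -> U)
    (injf : injective f) (injg : injective g) (injgf : injective (g \o f))
    (v : fi_obj S),
    fi_map injgf v = fi_map injg (fi_map injf v)
}.

Definition is_sub_fi_module (R : comPzRingType) (V : fi_module R)
    (W : forall S : finType, V S -> Prop) :=
  (forall S, is_submodule (W S)) /\
  (forall (S T : finType) (f : S -> T) (injf : injective f) (v : V S),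
     W S v -> W T (fi_map V injf v)).

Definition is_proper_sub_fi_module (R : comPzRingType) (V : fi_module R)
    (W : forall S : finType, V S -> Prop) :=
  is_sub_fi_module W /\ exists (S : finType) (v : V S), ~ W S v.

(* ['I_n] plays the role of [n]; [s] lists a finite subset of the disjoint      *)
(* union of the modules V_n.                                                    *)
Definition fi_finitely_generated (R : comPzRingType) (V : fi_module R) :=
  exists s : seq {n : nat & V 'I_n},
    ~ exists W : forall S : finType, V S -> Prop,
        is_proper_sub_fi_module W /\
        forall x, x \in s -> W _ (tagged x).

Section DirectSum.
Variables (R : pzRingType) (I : finType) (D : I -> lmodType R).

Definition dsum := {dffun forall i : I, D i}.
HB.instance Definition _ := Choice.on dsum.

Definition dsum_zero : dsum := [ffun i => 0].
Definition dsum_opp (x : dsum) : dsum := [ffun i => - x i].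
Definition dsum_add (x y : dsum) : dsum := [ffun i => x i + y i].
Definition dsum_scale (a : R) (x : dsum) : dsum := [ffun i => a *: x i].

Fact dsum_addA : associative dsum_add.
Proof. by move=> x y z; apply/ffunP=> i; rewrite !ffunE addrA. Qed.
Fact dsum_addC : commutative dsum_add.
Proof. by move=> x y; apply/ffunP=> i; rewrite !ffunE addrC. Qed.
Fact dsum_add0 : left_id dsum_zero dsum_add.
Proof. by move=> x; apply/ffunP=> i; rewrite !ffunE add0r. Qed.
Fact dsum_addN : left_inverse dsum_zero dsum_opp dsum_add.
Proof. by move=> x; apply/ffunP=> i; rewrite !ffunE addNr. Qed.
HB.instance Definition _ :=
  GRing.isZmodule.Build dsum dsum_addA dsum_addC dsum_add0 dsum_addN.

Fact dsum_scaleA a b (x : dsum) :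
  dsum_scale a (dsum_scale b x) = dsum_scale (a * b) x.
Proof. by apply/ffunP=> i; rewrite !ffunE scalerA. Qed.
Fact dsum_scale1 : left_id 1 dsum_scale.
Proof. by move=> x; apply/ffunP=> i; rewrite !ffunE scale1r. Qed.
Fact dsum_scaleDr : right_distributive dsum_scale +%R.
Proof. by move=> a x y; apply/ffunP=> i; rewrite !ffunE scalerDr. Qed.
Fact dsum_scaleDl (x : dsum) : {morph dsum_scale^~ x : a b / a + b}.
Proof. by move=> a b; apply/ffunP=> i; rewrite !ffunE scalerDl. Qed.
HB.instance Definition _ := GRing.Zmodule_isLmodule.Build R dsum
  dsum_scaleA dsum_scale1 dsum_scaleDr dsum_scaleDl.

Lemma dsumD (x y : dsum) i : (x + y) i = x i + y i.
Proof. by rewrite ffunE. Qed.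
Lemma dsumZ a (x : dsum) i : (a *: x) i = a *: x i.
Proof. by rewrite ffunE. Qed.
Lemma dsum0 i : (0 : dsum) i = 0.
Proof. by rewrite ffunE. Qed.

Definition dsum_in (i : I) (v : D i) : dsum :=
  [ffun j => dfwith (fun k => 0 : D k) v j].

Lemma dsum_in_id i (v : D i) : dsum_in v i = v.
Proof. by rewrite ffunE dfwith_in. Qed.

Lemma dsum_in_neq i j (v : D i) : i != j -> dsum_in v j = 0.
Proof. by move=> ij; rewrite ffunE dfwith_out. Qed.

Fact dsum_in_linear i : linear (@dsum_in i).
Proof.
move=> a u v; apply/ffunP=> j; rewrite dsumD dsumZ.
have [<-|ij] := eqVneq i j; first by rewrite !dsum_in_id.
by rewrite !dsum_in_neq // scaler0 addr0.
Qed.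
HB.instance Definition _ i :=
  GRing.isLinear.Build R (D i) dsum _ (@dsum_in i) (@dsum_in_linear i).

Lemma dsum_sum_app J (r : seq J) (F : J -> dsum) i :
  (\sum_(j <- r) F j) i = \sum_(j <- r) F j i.
Proof. by elim/big_rec2: _ => [|j x y _ <-]; rewrite ?dsum0 ?dsumD. Qed.

Lemma dsum_decomp (x : dsum) : x = \sum_i dsum_in (x i).
Proof.
apply/ffunP=> j; rewrite dsum_sum_app (bigD1 j) //= dsum_in_id big1 ?addr0 //.
by move=> i ij; rewrite dsum_in_neq.
Qed.
End DirectSum.

Section Colimit.
Variables (R : pzRingType) (I : finType) (le : rel I) (D : I -> lmodType R).
Variable t : forall i j : I, le i j -> {linear D i -> D j}.

(* The colimit is the direct sum of the [D i] modulo the submodule generated    *)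
(* by the elements [dsum_in v - dsum_in (t le_ij v)].                           *)
Inductive colim_relator : dsum D -> Prop :=
  ColimRelator (i j : I) (le_ij : le i j) (v : D i) :
    colim_relator (dsum_in v - dsum_in (t le_ij v)).

Definition colim_ker : {pred dsum D} := fun x => `[< generated colim_relator x >].

Lemma colim_kerP x : reflect (generated colim_relator x) (x \in colim_ker).
Proof. exact: asboolP. Qed.

Fact colim_ker_lin a x y :
  x \in colim_ker -> y \in colim_ker -> a *: x + y \in colim_ker.
Proof.
move=> /colim_kerP kx /colim_kerP ky; apply/colim_kerP => W sW rW.
by apply: sW.2; [exact: kx | exact: ky].
Qed.

Fact colim_ker_zmod : zmod_closed colim_ker.
Proof.
split=> [|x y kx ky]; first by apply/colim_kerP => W [].
by rewrite addrC -scaleN1r colim_ker_lin.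
Qed.
HB.instance Definition _ := GRing.isZmodClosed.Build (dsum D) colim_ker colim_ker_zmod.

Definition colim := Quotient.quot colim_ker.
HB.instance Definition _ := Choice.on colim.
HB.instance Definition _ := GRing.Zmodule.on colim.

Definition colim_pi (x : dsum D) : colim := \pi_(Quotient.quot colim_ker) x.

Lemma colim_pi_eq x y : colim_pi x = colim_pi y <-> x - y \in colim_ker.
Proof.
by split=> [/eqP|xy]; [rewrite -Quotient.idealrBE | apply/eqP; rewrite -Quotient.idealrBE].
Qed.

Lemma colim_piD x y : colim_pi (x + y) = colim_pi x + colim_pi y.
Proof. exact: (@pi_addr _ _ _ _ _ (Quotient.quot colim_ker)). Qed.

Lemma colim_pi_repr (q : colim) : colim_pi (repr (q : Quotient.quot colim_ker)) = q.
Proof. exact: reprK. Qed.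

Definition colim_scale (a : R) (q : colim) : colim :=
  colim_pi (a *: repr (q : Quotient.quot colim_ker)).

Lemma colim_piZ a x : colim_pi (a *: x) = colim_scale a (colim_pi x).
Proof.
apply/colim_pi_eq; rewrite -scalerBr -[_ *: _]addr0.
apply: colim_ker_lin (rpred0 _).
by apply/colim_pi_eq; rewrite colim_pi_repr.
Qed.

Fact colim_scaleA a b (q : colim) :
  colim_scale a (colim_scale b q) = colim_scale (a * b) q.
Proof. by rewrite -[q]colim_pi_repr -!colim_piZ scalerA. Qed.
Fact colim_scale1 : left_id 1 colim_scale.
Proof. by move=> q; rewrite -[q]colim_pi_repr -!colim_piZ scale1r. Qed.
Fact colim_scaleDr : right_distributive colim_scale +%R.
Proof.
move=> a p q; rewrite -[p]colim_pi_repr -[q]colim_pi_repr.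
by rewrite -colim_piD -!colim_piZ scalerDr colim_piD.
Qed.
Fact colim_scaleDl (q : colim) : {morph colim_scale^~ q : a b / a + b}.
Proof.
by move=> a b; rewrite -[q]colim_pi_repr -!colim_piZ scalerDl colim_piD.
Qed.
HB.instance Definition _ := GRing.Zmodule_isLmodule.Build R colim
  colim_scaleA colim_scale1 colim_scaleDr colim_scaleDl.

Fact colim_pi_linear : linear colim_pi.
Proof. by move=> a x y; rewrite colim_piD colim_piZ. Qed.
HB.instance Definition _ :=
  GRing.isLinear.Build R (dsum D) colim _ colim_pi colim_pi_linear.

Definition colim_in (i : I) (v : D i) : colim := colim_pi (dsum_in v).

Fact colim_in_linear i : linear (@colim_in i).
Proof. by move=> a u v; rewrite /colim_in !linearP. Qed.
HB.instance Definition _ i :=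
  GRing.isLinear.Build R (D i) colim _ (@colim_in i) (@colim_in_linear i).

Lemma colim_in_compat i j (le_ij : le i j) (v : D i) :
  colim_in (t le_ij v) = colim_in v.
Proof.
by apply/esym/colim_pi_eq/colim_kerP => W _; apply; exact: ColimRelator.
Qed.

(* The map out of the colimit induced by a family [g]; it is meaningful when    *)
(* [g] is a cocone, as then it does not depend on the choice of representative  *)
(* ([colim_desc_in], [colim_desc_unique]).                                      *)
Definition colim_desc (M : lmodType R) (g : forall i, {linear D i -> M})
    (q : colim) : M :=
  \sum_i g i ((repr (q : Quotient.quot colim_ker) : dsum D) i).

Section Desc.
Variables (M : lmodType R) (g : forall i, {linear D i -> M}).
Hypothesis g_cocone : forall i j (le_ij : le i j) v, g j (t le_ij v) = g i v.

Let gsum (x : dsum D) := \sum_i g i (x i).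

Let gsum_lin a x y : gsum (a *: x + y) = a *: gsum x + gsum y.
Proof.
rewrite /gsum scaler_sumr -big_split; apply: eq_bigr => i _.
by rewrite dsumD dsumZ linearP.
Qed.

Let gsum_in i (v : D i) : gsum (dsum_in v) = g i v.
Proof.
rewrite /gsum (bigD1 i) //= dsum_in_id big1 ?addr0 // => j ij.
by rewrite dsum_in_neq ?linear0 // eq_sym.
Qed.

Let gsumB x y : gsum (x - y) = gsum x - gsum y.
Proof. by rewrite [x - y]addrC [RHS]addrC -[- y]scaleN1r gsum_lin scaleN1r. Qed.

Let gsum_ker x : x \in colim_ker -> gsum x = 0.
Proof.
move/colim_kerP/(_ (fun y => gsum y = 0)); apply=> [|_ [i j le_ij v]].
  split=> [|a u v u0 v0]; last by rewrite gsum_lin u0 v0 scaler0 addr0.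
  by rewrite -[0](subrr 0) gsumB subrr.
by rewrite gsumB !gsum_in g_cocone subrr.
Qed.

Lemma colim_desc_pi x : colim_desc g (colim_pi x) = \sum_i g i (x i).
Proof.
apply/eqP; rewrite -subr_eq0; apply/eqP; rewrite -[LHS]gsumB.
by apply/gsum_ker/colim_pi_eq; rewrite colim_pi_repr.
Qed.

Lemma colim_desc_linear : linear (colim_desc g).
Proof.
move=> a p q; rewrite -[p]colim_pi_repr -[q]colim_pi_repr -linearP.
by rewrite !colim_desc_pi -/(gsum _) gsum_lin.
Qed.

Lemma colim_desc_in i v : colim_desc g (colim_in v) = g i v.
Proof. by rewrite colim_desc_pi -/(gsum _) gsum_in. Qed.

Lemma colim_desc_unique (h : {linear colim -> M}) :
  (forall i (v : D i), h (colim_in v) = g i v) -> h =1 colim_desc g.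
Proof.
move=> hg q; rewrite -[q]colim_pi_repr colim_desc_pi.
rewrite [in LHS](dsum_decomp (repr _)) !linear_sum.
by apply: eq_bigr => i _; exact: hg.
Qed.
End Desc.
End Colimit.

Section SubsetColimit.
Variables (R : comPzRingType) (V : fi_module R) (N n : nat).

Definition small_subset := {S : {set 'I_n} | (#|S| <= N)%N}.

Definition small_le (S T : small_subset) := val S \subset val T.

Definition carrier (S : small_subset) : finType := {x : 'I_n | x \in val S}.

Definition incl (S T : small_subset) (leST : small_le S T) (x : carrier S) :
  carrier T := exist _ (val x) (subsetP leST _ (valP x)).

Lemma incl_inj S T (leST : small_le S T) : injective (incl leST).
Proof. by move=> x y /(congr1 val) xy; apply: val_inj. Qed.

Definition incl_full (S : small_subset) (x : carrier S) : 'I_n := val x.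

Lemma incl_full_inj S : injective (@incl_full S).
Proof. exact: val_inj. Qed.

Definition subset_trans S T (leST : small_le S T) :
  {linear V (carrier S) -> V (carrier T)} := fi_map V (@incl_inj S T leST).

Definition subset_colim : lmodType R := colim subset_trans.

Definition subset_colim_map : subset_colim -> V 'I_n :=
  colim_desc (t := subset_trans) (fun S => fi_map V (@incl_full_inj S)).

Lemma subset_cocone S T (leST : small_le S T) (v : V (carrier S)) :
  fi_map V (@incl_full_inj T) (subset_trans leST v) =
  fi_map V (@incl_full_inj S) v.
Proof.
by rewrite -(fi_map_comp _ _ (@incl_full_inj S : injective (_ \o incl leST))).
Qed.

Lemma subset_colim_map_linear : linear subset_colim_map.
Proof. exact: colim_desc_linear subset_cocone. Qed.
HB.instance Definition _ := GRing.isLinear.Build R subset_colim (V 'I_n) _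
  subset_colim_map subset_colim_map_linear.

Lemma subset_colim_map_in S (v : V (carrier S)) :
  subset_colim_map (colim_in subset_trans v) = fi_map V (@incl_full_inj S) v.
Proof. exact: colim_desc_in subset_cocone _ _. Qed.
End SubsetColimit.
Arguments subset_colim_map {R} V N n.

(* Main.v *)
(* Let F -> V be the surjection from the free FI-module on the finitely many   *)
(* generators of V, and let K be its kernel.  As in Sam and Snowden's Groebner  *)
(* methods, order the basis of each F_n lexicographically, compatibly with      *)
(* increasing maps [n] -> [n'], and attach to each basis element the ideal of   *)
(* leading coefficients of K there.  By Dickson's lemma the basis elements are  *)
(* well-quasi-ordered by divisibility under increasing maps, so the ascending   *)
(* chain condition in R yields finitely many basis elements whose leading       *)
(* coefficient ideals account for all others; hence K is generated in degrees   *)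
(* at most some B.  Take N to be the maximum of B and the generator degrees.    *)
(* The surjection F_n -> V_n then factors through a surjection from F_n onto    *)
(* the colimit, which kills the generators of K_n because each of these is      *)
(* supported on a subset of size at most N.                                     *)
Require Import Defs.
From mathcomp Require Import all_boot all_order all_algebra.
From HB Require Import structures.
From mathcomp Require Import boolp zify.

Set Implicit Arguments.
Unset Strict Implicit.
Unset Printing Implicit Defensive.

Import Order.TTheory GRing.Theory.

(** A finite presentation in degrees at most N forces the colimit description. The surjection F_n ->
    V_n is [lincomb] of [eval_mon], and its relations are bounded by [kernel_bounded], an instance
    of the abstract division argument [bounded_generation]; the order input is [mon_wqo], reduced to
    [dickson] by [mon_divides]. In [subset_colim_bij], monomials span the colimit
    ([colim_mon_spans]), and a relation coming from degree at most N already holds there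
    ([colim_mon_act]), which gives injectivity; surjectivity holds because every evaluated monomial
    lifts to the colimit. *)

Lemma homo_ltn_leq (psi : nat -> nat) :
  {homo psi : i j / i < j} -> {homo psi : i j / i <= j}.
Proof. by move=> h i j; rewrite leq_eqVlt => /orP[/eqP->|/h/ltnW]. Qed.

(** Repeatedly pick an index where [F] is minimal on the remaining tail; each later value is then at
    least the one picked. *)
Lemma nondecreasing_subseq (F : nat -> nat) :
  exists2 psi : nat -> nat, {homo psi : i j / i < j} &
    {homo F \o psi : i j / i <= j}.
Proof.
have minF k : exists j, k <= j /\ forall i, k <= i -> F j <= F i.
  have ex : exists v, `[<exists2 i, k <= i & F i = v>].
    by exists (F k); apply/asboolP; exists k.
  case: (ex_minnP ex) => _ /asboolP[j kj <-] jmin.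
  by exists j; split=> // i ki; apply: jmin; apply/asboolP; exists i.
have [phi phiP] := choice minF.
pose psi := fix psi k := if k is k'.+1 then phi (psi k').+1 else phi 0.
have psiS : {homo psi : i j / i < j}.
  by apply: homo_ltn => [|k] /=; [exact: ltn_trans | exact: (phiP _).1].
exists psi => // i j ij /=.
have psi_ij := homo_ltn_leq psiS ij.
case: i ij psi_ij => [|i] ij psi_ij /=; first exact: (phiP 0).2.
by apply: (phiP _).2; apply: leq_trans psi_ij; exact: (phiP _).1.
Qed.

Lemma dickson (I : eqType) (F : I -> nat -> nat) (s : seq I) :
  exists2 psi : nat -> nat, {homo psi : i j / i < j} &
    forall a, a \in s -> {homo F a \o psi : i j / i <= j}.
Proof.
elim: s => [|a s [psi psiS psiF]]; first by exists id.
have [phi phiS phiF] := nondecreasing_subseq (F a \o psi).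
exists (psi \o phi) => [i j ij|b]; first exact/psiS/phiS.
rewrite inE => /orP[/eqP-> //|bs] i j ij /=.
by apply: (psiF b bs); exact: homo_ltn_leq.
Qed.

(** * Submodules and the ascending chain condition *)

Section Submodules.
Local Open Scope ring_scope.

Lemma generated_submod (R : pzRingType) (M : lmodType R) (X : M -> Prop) :
  is_submodule (generated X).
Proof.
split=> [W [] //|a u v Xu Xv W sW XW].
by apply: sW.2; [exact: Xu | exact: Xv].
Qed.

Lemma submodB (R : pzRingType) (M : lmodType R) (W : M -> Prop) u v :
  is_submodule W -> W u -> W v -> W (u - v).
Proof. by case=> _ WD Wu Wv; rewrite addrC -scaleN1r; exact: WD. Qed.

Lemma submod_sum (R : pzRingType) (M : lmodType R) (W : M -> Prop) (I : Type)
    (r : seq I) (F : I -> M) :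
  is_submodule W -> (forall i, W (F i)) -> W (\sum_(i <- r) F i).
Proof.
case=> W0 WD WF; elim/big_ind: _ => // u v Wu Wv.
by rewrite -[u]scale1r; exact: WD.
Qed.

(** The union of the chain is an ideal, and its finitely many generators all lie in some [J k]. *)
Lemma noetherian_acc (R : comPzRingType) (J : nat -> R^o -> Prop) :
  noetherian R -> (forall k, is_submodule (J k)) ->
  (forall k x, J k x -> J k.+1 x) ->
  exists k, forall x, J k.+1 x -> J k x.
Proof.
move=> noeth sJ incJ.
have monoJ i j x : (i <= j)%N -> J i x -> J j x.
  by move/subnK<-; elim: (j - i)%N => // k IH /IH; exact: incJ.
have sU : is_submodule (fun x => exists k, J k x).
  split=> [|a u v [i Ju] [j Jv]]; first by exists 0%N; exact: (sJ 0%N).1.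
  exists (maxn i j); apply: (sJ _).2.
    by apply: monoJ Ju; rewrite leq_maxl.
  by apply: monoJ Jv; rewrite leq_maxr.
have [s sP] := noeth _ sU.
have sU' : forall x, x \in s -> exists k, J k x.
  by move=> x xs; apply/sP => W _; exact.
have [k kP] : exists k, forall x, x \in s -> J k x.
  elim: (s) sU' => [|y r IH] sJx; first by exists 0%N.
  have [k kP] : exists k, forall x, x \in r -> J k x.
    by apply: IH => x xr; apply: sJx; rewrite inE xr orbT.
  have [l lP] := sJx y (mem_head _ _).
  exists (maxn k l) => x; rewrite inE => /orP[/eqP->|/kP].
    by apply: monoJ lP; rewrite leq_maxr.
  by apply: monoJ; rewrite leq_maxl.
exists k => x Jx; suff /sP : exists k, J k x by apply.
by exists k.+1.
Qed.

End Submodules.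

(** If every finite list fails, repeatedly adjoining an element not above the list so far builds a
    sequence with no good pair. *)
Lemma finite_basis (A : Type) (r : A -> A -> Prop) :
  (forall a : nat -> A, exists i j, i < j /\ r (a i) (a j)) ->
  exists s : seq A, forall y, exists2 x, List.In x s & r x y.
Proof.
move=> good; apply: contrapT => bad.
have ex s : exists y, forall x, List.In x s -> ~ r x y.
  apply: contrapT => sbad; apply: bad; exists s => y.
  apply: contrapT => ybad; apply: sbad; exists y => x xs rxy.
  by apply: ybad; exists x.
have [f fP] := choice ex.
pose L := fix L k := if k is k'.+1 then f (L k') :: L k' else [::].
have inL i j : i < j -> List.In (f (L i)) (L j).
  elim: j => // j IH; rewrite ltnS leq_eqVlt => /orP[/eqP->|/IH]; first by left.
  by right.
have [i [j [ij]]] := good (f \o L).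
exact/fP/inL.
Qed.

(** * Bounded generation by leading coefficients *)

Section Groebner.
Local Open Scope ring_scope.
(** Abstract setting: [M n] is the monomial basis of F_n, [code] carries its total order, [hom]
    singles out the order-preserving transition maps, and [K] is the family of relation modules. *)
Variables (R : comPzRingType) (d : Order.disp_t) (T : orderType d).
Variables (M : nat -> finType) (code : forall n, M n -> T).
Variable hom : forall n n', (M n -> M n') -> Prop.
Variable K : forall n, {ffun M n -> R^o} -> Prop.
Arguments hom {n n'}.
Arguments K {n}.

Definition push (A B : finType) (phi : A -> B) (c : {ffun A -> R^o}) :
  {ffun B -> R^o} := [ffun w => \sum_(u | phi u == w) c u].

Hypothesis noeth : noetherian R.
Hypothesis code_inj : forall n, injective (@code n).
Hypothesis hom_mono : forall n n' (phi : M n -> M n'),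
  hom phi -> {homo phi : u v / (code u < code v)%O}.
Hypothesis K_sub : forall n, is_submodule (@K n).
Hypothesis K_push : forall n n' (phi : M n -> M n') c,
  hom phi -> K c -> K (push phi c).
(** A whole subsequence of comparable elements is required, not just one good pair: the leading
    coefficient ideals have to form a chain along it. *)
Hypothesis wqo : forall a : nat -> {n & M n},
  exists2 psi : nat -> nat, {homo psi : i j / (i < j)%N} &
    forall i j, (i < j)%N ->
      exists2 phi, hom phi & phi (tagged (a (psi i))) = tagged (a (psi j)).

(** The leading coefficient ideal of [K] at [u]; allowing [r] to be 0 makes it a submodule. *)
Let lead n (u : M n) (r : R^o) :=
  exists c, [/\ K c, c u = r & forall w, (code u < code w)%O -> c w = 0].

Let lead_sub n (u : M n) : is_submodule (lead u).
Proof.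
split=> [|a x y [c [Kc <- cw]] [c' [Kc' <- cw']]].
  exists 0; split=> [||w _]; rewrite ?ffunE //.
  exact: (K_sub n).1.
exists (a *: c + c'); split=> [||w uw]; rewrite ?ffunE //.
  exact: (K_sub n).2.
by rewrite cw // cw' // scaler0 addr0.
Qed.

Lemma hom_inj n n' (phi : M n -> M n') : hom phi -> injective phi.
Proof.
move=> hphi u v phi_uv; apply: code_inj.
have [] := ltgtP (code u) (code v) => // /(hom_mono hphi);
  by rewrite phi_uv ltxx.
Qed.

Let push_lead n n' (phi : M n -> M n') u (c : {ffun M n -> R^o}) : hom phi ->
  (forall w, (code u < code w)%O -> c w = 0) ->
  push phi c (phi u) = c u /\
  forall w, (code (phi u) < code w)%O -> push phi c w = 0.
Proof.
move=> hphi cw; have inj := hom_inj hphi.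
split=> [|w uw]; rewrite ffunE.
  by rewrite (eq_bigl (pred1 u)) ?big_pred1_eq // => v; exact: inj_eq.
apply: big1 => v /eqP phi_v; apply: cw.
have [//|vu|/code_inj uv] := ltgtP (code u) (code v).
- by move: uw; rewrite -phi_v ltNge ltW // hom_mono.
- by move: uw; rewrite -phi_v uv ltxx.
Qed.

Let lead_mono n n' (phi : M n -> M n') u r : hom phi -> lead u r ->
  lead (phi u) r.
Proof.
move=> hphi [c [Kc <- cw]].
have [p1 p2] := push_lead hphi cw.
by exists (push phi c); split=> //; exact: K_push.
Qed.

(** The reverse inclusion of ideals is [lead_mono], so divisibility here means that the two ideals
    coincide. *)
Let divides (x y : {n & M n}) :=
  exists2 phi, hom phi & phi (tagged x) = tagged y /\
    forall r, lead (tagged y) r -> lead (tagged x) r.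

Let divides_good (a : nat -> {n & M n}) : exists i j, (i < j)%N /\ divides (a i) (a j).
Proof.
have [psi psiS psiP] := wqo a.
have [||k kP] := noetherian_acc (J := fun k => lead (tagged (a (psi k)))) noeth.
- by move=> k; exact: lead_sub.
- by move=> k x; have [phi hphi <-] := psiP k _ (leqnn _); exact: lead_mono.
exists (psi k), (psi k.+1); split; first exact: psiS.
by have [phi hphi e] := psiP k _ (leqnn _); exists phi.
Qed.

(** Division algorithm: the leading term of [c] is cancelled by pushing forward a relation attached
    to one of the finitely many basis elements. No coefficient is inverted, since the ideal at the
    divisor contains the leading coefficient itself. *)
Lemma bounded_generation : exists B, forall n (c : {ffun M n -> R^o}), K c ->
  generated (fun c' => exists n0 (c0 : {ffun M n0 -> R^o}) (phi : M n0 -> M n),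
    [/\ (n0 <= B)%N, K c0, hom phi & c' = push phi c0]) c.
Proof.
have [s sP] := finite_basis divides_good.
exists (\max_(x <- s) tag x)%N => n c.
have leB x : List.In x s -> (tag x <= \max_(x <- s) tag x)%N.
  elim: (s) => //= y r IH; rewrite big_cons leq_max => -[->|/IH->];
  by rewrite ?leqnn ?orbT.
(* The induction measures the down-set of the support rather than the support, because a subtraction
   may create new smaller terms. *)
pose below (e : {ffun M n -> R^o}) :=
  [set w : M n | [exists v, (e v != 0) && (code w <= code v)%O]].
have [k] := ubnP #|below c|; elim: k c => // k IH c; rewrite ltnS => ck Kc.
have [/eqP->|[v0 cv0]] : c == 0 \/ exists v, c v != 0.
- have [|c0] := pickP (fun v => c v != 0); first by right; exists x.
  by left; apply/eqP/ffunP=> v; rewrite ffunE; apply/eqP/negPn; rewrite c0.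
- exact: (generated_submod _).1.
have [u cu umax] := @arg_maxP _ _ _ v0 (fun v => c v != 0) (@code n) cv0.
have cw w : (code u < code w)%O -> c w = 0.
  by move=> uw; apply/eqP; apply: contraTT uw => /umax /=; rewrite leNgt.
have [x xs [phi hphi [phi_x leadx]]] := sP (Tagged M u).
have [|c0 [Kc0 c0x c0w]] := leadx (c u); first by exists c.
have [] := push_lead hphi c0w; rewrite phi_x /= c0x => p1 p2.
rewrite -[c](subrK (push phi c0)) -[c - _]scale1r.
apply: (generated_submod _).2; last first.
  by move=> W _; apply; exists (tag x), c0, phi; split=> //; exact: leB.
apply: IH; last exact: submodB (K_push _ _).
apply: leq_trans ck; apply: proper_card; apply/properP.
have belowu v : (c - push phi c0) v != 0 -> (code v < code u)%O.
  rewrite 2!ffunE => nz; rewrite ltNge; apply: contraNN nz.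
  rewrite le_eqVlt => /orP[/eqP/code_inj <-|uv].
    by rewrite p1 subrr.
  by rewrite cw // p2 // subrr.
split.
  apply/subsetP=> w; rewrite !inE => /existsP[v /andP[/belowu vu wv]].
  by apply/existsP; exists u; rewrite cu (le_trans wv) // ltW.
exists u; first by rewrite inE; apply/existsP; exists u; rewrite cu lexx.
rewrite inE; apply/existsP => -[v /andP[/belowu vu]].
by rewrite leNgt vu.
Qed.

End Groebner.

(** * Monomials of a free FI-module *)

Section Monomials.
Variables (k : nat) (m : 'I_k -> nat).

(** The basis of the direct sum over [i] of the free modules on the injections from ['I_(m i)] to
    [S], that is, of the free FI-module with one generator in each degree [m i]. *)
Definition mon (S : finType) : finType :=
  {i : 'I_k & {f : {ffun 'I_(m i) -> S} | injectiveb f}}.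

Definition mon_fun S (u : mon S) : 'I_(m (tag u)) -> S := val (tagged u).
Arguments mon_fun {S} u.

Lemma mon_fun_inj S (u : mon S) : injective (mon_fun u).
Proof. exact/injectiveP/(valP (tagged u)). Qed.

Lemma mon_of_subproof (S : finType) i (f : 'I_(m i) -> S) :
  injective f -> injectiveb (finfun f).
Proof. by move=> injf; apply/injectiveP => a b; rewrite !ffunE; exact: injf. Qed.

Definition mon_of (S : finType) i (f : 'I_(m i) -> S) (injf : injective f) : mon S :=
  Tagged _ (exist (fun f : {ffun 'I_(m i) -> S} => injectiveb f) _
    (mon_of_subproof injf)).

Lemma mon_ofE (S : finType) i (f : 'I_(m i) -> S) (injf : injective f) a :
  mon_fun (mon_of injf) a = f a.
Proof. exact: ffunE. Qed.

Definition act (S S' : finType) (g : S -> S') (injg : injective g) (u : mon S) :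
    mon S' :=
  mon_of (inj_comp injg (@mon_fun_inj _ u)).

Definition points (S : finType) (u : mon S) : seq S :=
  [seq mon_fun u a | a <- enum 'I_(m (tag u))].

Definition positions n (u : mon 'I_n) : seq nat := map val (points u).

Definition mon_code n (u : mon 'I_n) : (nat *l seqlexi nat)%type :=
  (val (tag u), positions u).

Lemma points_act (S S' : finType) (g : S -> S') (injg : injective g) u :
  points (act injg u) = map g (points u).
Proof. by rewrite -map_comp; apply: eq_map => a; rewrite mon_ofE. Qed.

Lemma mon_code_inj n : injective (@mon_code n).
Proof.
move=> [i [f injf]] [i' [f' injf']] [/val_inj ii']; subst i'.
rewrite /positions => /(inj_map val_inj) /eq_in_map ff'.
congr Tagged; apply: val_inj; apply/ffunP => a.
exact/ff'/mem_enum.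
Qed.

Lemma ltxi_map n n' (g : 'I_n -> 'I_n') (s t : seq 'I_n) :
  {homo g : x y / x < y} ->
  (map val s < map val t :> seqlexi nat)%O ->
  (map val (map g s) < map val (map g t) :> seqlexi nat)%O.
Proof.
move=> gS; elim: s t => [|x s IH] [|y t] //=.
rewrite !ltxi_cons !leEnat; case: (ltngtP x y) => //= [xy _|/val_inj-> /IH st].
  have := gS _ _ xy; lia.
by rewrite leqnn.
Qed.

(** Restricted to increasing maps, since a general injection does not respect the lexicographic
    order. *)
Definition mon_hom n n' (phi : mon 'I_n -> mon 'I_n') :=
  exists (g : 'I_n -> 'I_n') (injg : injective g),
    {homo g : x y / x < y} /\ phi = act injg.

Lemma mon_hom_code n n' (phi : mon 'I_n -> mon 'I_n') :
  mon_hom phi -> {homo phi : u v / (mon_code u < mon_code v)%O}.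
Proof.
move=> [g [injg [gS ->]]] u v; rewrite !ltxi_pair => /andP[-> /= /implyP uv].
by apply/implyP => /uv; rewrite /positions !points_act; exact: ltxi_map.
Qed.

(** No gap may shrink: neither to the left of a marked point, nor to its right, nor between two of
    them. The subtraction is truncated, so the last hypothesis constrains only pairs with
    [f a < f b]. *)
Lemma increasing_extension (A : finType) n n' (f : A -> 'I_n) (f' : A -> 'I_n') :
    injective f -> n <= n' -> (forall a, f a <= f' a) ->
    (forall a, n - f a <= n' - f' a) -> (forall a b, f b - f a <= f' b - f' a) ->
  exists2 g : 'I_n -> 'I_n', {homo g : x y / x < y} & forall a, g (f a) = f' a.
Proof.
move=> injf nn' ff' nff' fab.
(* Shift [x] by the largest displacement [f' a - f a] over the marked points    *)
(* [f a] weakly to the left of [x].                                             *)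
pose sh x := \max_(a | f a <= x) (f' a - f a).
have g_lt (x : 'I_n) : x + sh x < n'.
  suff : sh x <= n' - n by have := ltn_ord x; lia.
  apply/bigmax_leqP => a _.
  have := nff' a; have := ltn_ord (f a); have := ltn_ord (f' a); lia.
exists (fun x => Ordinal (g_lt x)) => [x y xy | b] /=.
  suff : sh x <= sh y by lia.
  apply/bigmax_leqP => a ax; apply: leq_bigmax_cond; lia.
apply: val_inj => /=; suff -> : sh (f b) = f' b - f b by rewrite subnKC.
apply/eqP; rewrite eqn_leq leq_bigmax_cond // andbT.
apply/bigmax_leqP => a; rewrite leq_eqVlt => /orP[/eqP/val_inj/injf-> //|ab].
have := fab a b; have := ff' a; have := ff' b; lia.
Qed.

(* Divisibility amounts to monotonicity of all truncated differences of these   *)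
(* entries.  Since both [tag u - 0] and [k - tag u] grow, the tag is constant.  *)
Definition features n (u : mon 'I_n) : seq nat :=
  [:: 0, n, val (tag u), k & positions u].

Lemma mon_divides n n' (u : mon 'I_n) (v : mon 'I_n') :
  (forall a b, a < 4 + \max_i m i -> b < 4 + \max_i m i ->
    nth 0 (features u) b - nth 0 (features u) a <=
    nth 0 (features v) b - nth 0 (features v) a) ->
  exists2 phi, mon_hom phi & phi u = v.
Proof.
case: u v => [i f] [i' f'] uv.
have ii' : i = i'.
  apply: val_inj; have := uv 0 2 isT isT; have := uv 2 3 isT isT.
  rewrite /=; have := ltn_ord i; have := ltn_ord i'; lia.
subst i'; set p : mon 'I_n := existT _ i f in uv *.
set q : mon 'I_n' := existT _ i f' in uv *.
have P_nth n0 (w : mon 'I_n0) (a : 'I_(m (tag w))) :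
    nth 0 (positions w) a = mon_fun w a.
  by rewrite /positions -map_comp (nth_map a) ?size_enum_ord // nth_ord_enum.
have mi (a : 'I_(m i)) : 4 + a < 4 + \max_i m i.
  by rewrite ltn_add2l (leq_trans (ltn_ord a)) // leq_bigmax.
have Np (a : 'I_(m i)) : nth 0 (features p) (4 + a) = mon_fun p a.
  exact: P_nth.
have Nq (a : 'I_(m i)) : nth 0 (features q) (4 + a) = mon_fun q a.
  exact: P_nth.
(* Entry 0 of [features] is the left end, entry 1 the right end, and entries from 4 on are the
   points, so feature differences are exactly the gaps to compare. *)
have [||a|a|a b|g gS gf] := @increasing_extension _ _ _ (mon_fun p) (mon_fun q).
- exact: mon_fun_inj.
- by have := uv 0 1 isT isT; rewrite /= !subn0.
- by have := uv 0 _ isT (mi a); rewrite Np Nq /= !subn0.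
- by have := uv _ 1 (mi a) isT; rewrite Np Nq.
- by have := uv _ _ (mi a) (mi b); rewrite !Np !Nq.
have injg : injective g.
  move=> x y gxy; have [/gS|/gS|/val_inj //] := ltngtP x y;
  by rewrite gxy ltnn.
exists (act injg); first by exists g, injg.
apply: mon_code_inj; congr pair; rewrite /positions points_act /points.
by rewrite -!map_comp; apply: eq_map => a; rewrite /= gf.
Qed.

Lemma mon_wqo (x : nat -> {n & mon 'I_n}) :
  exists2 psi : nat -> nat, {homo psi : i j / i < j} &
    forall i j, i < j ->
      exists2 phi, mon_hom phi & phi (tagged (x (psi i))) = tagged (x (psi j)).
Proof.
(* Four leading entries and at most [\max_i m i] positions: only finitely many differences occur, as
   Dickson's lemma requires. *)
pose D := 4 + \max_i m i.
have [psi psiS psiF] := dickson (fun (ab : 'I_D * 'I_D) j =>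
  nth 0 (features (tagged (x j))) ab.2 - nth 0 (features (tagged (x j))) ab.1)
  (enum {: 'I_D * 'I_D}).
exists psi => // i j ij; apply: mon_divides => a b aD bD.
exact: (psiF (Ordinal aD, Ordinal bD) (mem_enum _ _) _ _ (ltnW ij)).
Qed.

End Monomials.

(** * Presentations and the colimit *)

Section LinearCombinations.
Local Open Scope ring_scope.
Variables (R : comPzRingType) (E : lmodType R).

Definition lincomb (A : finType) (x : A -> E) (c : {ffun A -> R^o}) : E :=
  \sum_u (c u : R) *: x u.

Lemma lincombP (A : finType) (x : A -> E) a (c c' : {ffun A -> R^o}) :
  lincomb x (a *: c + c') = a *: lincomb x c + lincomb x c'.
Proof.
rewrite /lincomb scaler_sumr -big_split; apply: eq_bigr => u _.
by rewrite !ffunE scalerDl scalerA.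
Qed.

Lemma lincomb0 (A : finType) (x : A -> E) : lincomb x 0 = 0.
Proof. by apply: big1 => u _; rewrite ffunE scale0r. Qed.

Lemma lincomb_delta (A : finType) (x : A -> E) u :
  lincomb x [ffun v => (v == u)%:R] = x u.
Proof.
rewrite /lincomb (bigD1 u) //= ffunE eqxx scale1r big1 ?addr0 // => v vu.
by rewrite ffunE (negPf vu) scale0r.
Qed.

Lemma lincomb_push (A B : finType) (phi : A -> B) (x : B -> E) c :
  lincomb x (push phi c) = lincomb (x \o phi) c.
Proof.
rewrite /lincomb [RHS](partition_big phi predT) //=; apply: eq_bigr => w _.
by rewrite ffunE scaler_suml; apply: eq_bigr => u /eqP ->.
Qed.

Lemma lincomb_sub (A : finType) (x : A -> E) :
  is_submodule (fun c => lincomb x c = 0).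
Proof.
split=> [|a c c' c0 c0']; first exact: lincomb0.
by rewrite lincombP c0 c0' scaler0 addr0.
Qed.

Lemma lincomb_image_sub (A : finType) (x : A -> E) :
  is_submodule (fun y => exists c, lincomb x c = y).
Proof.
split=> [|a _ _ [c <-] [c' <-]]; first by exists 0; exact: lincomb0.
by exists (a *: c + c'); exact: lincombP.
Qed.

End LinearCombinations.

Lemma lincomb_linear (R : comPzRingType) (E F : lmodType R)
    (h : {linear E -> F}) (A : finType) (x : A -> E) c :
  h (lincomb x c) = lincomb (h \o x) c.
Proof. by rewrite linear_sum; apply: eq_bigr => u _; rewrite linearZ. Qed.

Lemma submod_preim (R : pzRingType) (E F : lmodType R) (h : {linear E -> F})
    (W : F -> Prop) :
  is_submodule W -> is_submodule (fun x => W (h x)).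
Proof.
by case=> W0 WD; split=> [|a u v Wu Wv]; rewrite ?linear0 // linearP; exact: WD.
Qed.

Lemma fi_map_ext (R : comPzRingType) (V : fi_module R) (S T : finType)
    (f g : S -> T) (injf : injective f) (injg : injective g) v :
  f =1 g -> fi_map V injf v = fi_map V injg v.
Proof.
move=> /funext fg; subst g; congr (fi_map V _ v); exact: Prop_irrelevance.
Qed.

Lemma fi_map_mul (R : comPzRingType) (V : fi_module R) (S T U : finType)
    (f : S -> T) (g : T -> U) (h : S -> U) (injf : injective f)
    (injg : injective g) (injh : injective h) v :
  g \o f =1 h -> fi_map V injg (fi_map V injf v) = fi_map V injh v.
Proof.
move=> gfh; rewrite -(fi_map_comp _ _ (inj_comp injg injf)).
exact: fi_map_ext.
Qed.

Section Presentation.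
Variables (R : comPzRingType) (V : fi_module R).
Variables (k : nat) (m : 'I_k -> nat) (gen : forall i : 'I_k, V 'I_(m i)).

Definition eval_mon (S : finType) (u : mon m S) : V S :=
  fi_map V (@mon_fun_inj _ _ _ u) (gen (tag u)).

Lemma eval_act (S S' : finType) (g : S -> S') (injg : injective g) (u : mon m S) :
  eval_mon (act injg u) = fi_map V injg (eval_mon u).
Proof. by apply/esym/fi_map_mul => a; rewrite mon_ofE. Qed.

(** The relations are stable under every increasing map because evaluation is natural; the
    conclusion keeps only the injectivity of [g]. *)
Lemma kernel_bounded : noetherian R ->
  exists B, forall n (c : {ffun mon m 'I_n -> R^o}),
    lincomb (@eval_mon 'I_n) c = 0%R ->
    generated (fun c' => exists n0 (c0 : {ffun mon m 'I_n0 -> R^o})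
        (g : 'I_n0 -> 'I_n) (injg : injective g),
      [/\ n0 <= B, lincomb (@eval_mon 'I_n0) c0 = 0%R & c' = push (act injg) c0]) c.
Proof.
move=> noeth.
have [|||||B BP] := @bounded_generation R _ _ _ (@mon_code k m) (@mon_hom k m)
  (fun n c => lincomb (@eval_mon 'I_n) c = 0%R) noeth.
- exact: mon_code_inj.
- exact: mon_hom_code.
- by move=> n; exact: lincomb_sub.
- move=> n n' _ c [g [injg [_ ->]]] c0; rewrite lincomb_push.
  rewrite -[RHS](linear0 (fi_map V injg)) -c0 lincomb_linear.
  by apply: eq_bigr => u _; rewrite /= eval_act.
- exact: mon_wqo.
exists B => n c /BP gc W sW XW; apply: gc => // c' [n0 [c0 [phi [n0B c0K]]]].
by case=> [g [injg [_ ->]]] ->; apply: XW; exists n0, c0, g, injg.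
Qed.

Hypothesis gen_spans : forall W : forall S : finType, V S -> Prop,
  is_sub_fi_module W -> (forall i, W _ (gen i)) -> forall S v, W S v.

(** The spans of the evaluated monomials form a sub-FI-module containing every generator. *)
Lemma span_eval (S : finType) (v : V S) :
  generated (fun v' => exists u, v' = eval_mon u) v.
Proof.
apply: (gen_spans (W := fun S => generated (fun v' => exists u, v' = @eval_mon S u))).
  split=> [T|T U f injf w gw W sW XW]; first exact: generated_submod.
  apply: (gw (fun w => W (fi_map V injf w))); first exact: submod_preim.
  by move=> _ [u ->]; apply: XW; exists (act injf u); rewrite eval_act.
move=> i W _; apply.
exists (mon_of (@inj_id 'I_(m i))); rewrite /eval_mon.
rewrite -[LHS](fi_map_id (@inj_id _)); apply: fi_map_ext => a.
by rewrite mon_ofE.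
Qed.

(** * Comparing the free module with the colimit over small subsets *)

Section Colim.
Variables N n : nat.

Section Image.
Variables (A : finType) (f : A -> 'I_n) (injf : injective f) (AN : #|A| <= N).

Lemma image_small : #|f @: [set: A]| <= N.
Proof. by rewrite card_imset // cardsT. Qed.

Definition image_set : small_subset N n := exist _ (f @: [set: A]) image_small.

Definition to_image (a : A) : carrier image_set :=
  exist _ (f a) (imset_f f (in_setT a)).

Lemma to_image_inj : injective to_image.
Proof. by move=> a b /(congr1 val)/injf. Qed.

(** An injection of a set of size at most N into [n] factors through its image, a stage of the
    colimit. *)
Definition image_in (v : V A) : subset_colim V N n :=
  colim_in (@Defs.subset_trans R V N n) (fi_map V to_image_inj v).

Lemma image_in_linear : linear image_in.
Proof. by move=> a u v; rewrite /image_in !linearP. Qed.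
HB.instance Definition _ := GRing.isLinear.Build R (V A) (subset_colim V N n) _
  image_in image_in_linear.

Lemma colim_map_image v : subset_colim_map V N n (image_in v) = fi_map V injf v.
Proof. by rewrite subset_colim_map_in; exact: fi_map_mul. Qed.

(** Any small subset containing the image gives the same class, by the colimit relation for the
    inclusion of the image. *)
Lemma image_in_factor (T : small_subset N n) (h : A -> carrier T)
    (injh : injective h) (v : V A) : (forall a, val (h a) = f a) ->
  colim_in (@Defs.subset_trans R V N n) (fi_map V injh v) = image_in v.
Proof.
move=> hf; have leT : small_le image_set T.
  by apply/subsetP => _ /imsetP[a _ ->]; rewrite -hf; exact: valP.
rewrite /image_in -(colim_in_compat _ leT); congr colim_in.
by apply/esym/fi_map_mul => a; apply: val_inj; rewrite /= hf.
Qed.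

End Image.

Lemma image_in_comp (A B : finType) (f : A -> B) (g : B -> 'I_n) (h : A -> 'I_n)
    (injf : injective f) (injg : injective g) (injh : injective h)
    (AN : #|A| <= N) (BN : #|B| <= N) v :
  g \o f =1 h -> image_in injh AN v = image_in injg BN (fi_map V injf v).
Proof.
move=> gfh; rewrite [RHS]/image_in.
rewrite (fi_map_mul _ _ (inj_comp (@to_image_inj _ _ injg BN) injf)) //.
by apply/esym/image_in_factor => a; exact: gfh.
Qed.

Hypothesis mN : forall i, m i <= N.

Lemma mon_small i : #|'I_(m i)| <= N.
Proof. by rewrite card_ord. Qed.

Definition colim_mon (u : mon m 'I_n) : subset_colim V N n :=
  image_in (@mon_fun_inj _ _ _ u) (mon_small _) (gen (tag u)).

Lemma colim_map_mon u : subset_colim_map V N n (colim_mon u) = eval_mon u.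
Proof. exact: colim_map_image. Qed.

Lemma colim_mon_spans (x : subset_colim V N n) : exists c, lincomb colim_mon c = x.
Proof.
suff colim_in_span : forall (S : small_subset N n) (v : V (carrier S)),
    exists c, lincomb colim_mon c = colim_in (@Defs.subset_trans R V N n) v.
  rewrite -[x]colim_pi_repr (dsum_decomp (repr _)) linear_sum.
  apply: (submod_sum (W := fun y => exists c, lincomb colim_mon c = y)) => [|S].
    exact: lincomb_image_sub.
  exact: colim_in_span.
move=> S v; have /(_ (fun w => exists c, lincomb colim_mon c =
  colim_in (@Defs.subset_trans R V N n) w)) := span_eval v.
apply; first exact: submod_preim (lincomb_image_sub _).
move=> _ [u ->]; exists [ffun w => (w == act (@incl_full_inj N n S) u)%:R]%R.
rewrite lincomb_delta; apply/esym/image_in_factor => a.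
by rewrite mon_ofE.
Qed.

(** For [n0 <= N], the monomials pushed along [g] reach the colimit through V_{n0}, so every
    relation among them in V_{n0} persists in the colimit. *)
Lemma colim_mon_act n0 (n0N : #|'I_n0| <= N) (g : 'I_n0 -> 'I_n)
    (injg : injective g) u :
  colim_mon (act injg u) = image_in injg n0N (eval_mon u).
Proof. by apply: image_in_comp => a; rewrite mon_ofE. Qed.

End Colim.

Lemma subset_colim_bij N :
  (forall i, m i <= N) ->
  (forall n (c : {ffun mon m 'I_n -> R^o}), lincomb (@eval_mon 'I_n) c = 0%R ->
    generated (fun c' => exists n0 (c0 : {ffun mon m 'I_n0 -> R^o})
        (g : 'I_n0 -> 'I_n) (injg : injective g),
      [/\ n0 <= N, lincomb (@eval_mon 'I_n0) c0 = 0%R & c' = push (act injg) c0]) c) ->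
  forall n, bijective (subset_colim_map V N n).
Proof.
move=> mN ker n; set F := subset_colim_map V N n.
have F_lincomb c : F (lincomb (colim_mon mN) c) = lincomb (@eval_mon 'I_n) c.
  rewrite /F lincomb_linear; apply: eq_bigr => u _.
  by rewrite /= colim_map_mon.
(* Write [x] as a combination of monomials: its coefficients form a relation in V_n, hence are
   generated by pushed relations of degree at most N, each zero in the colimit. *)
have F_ker x : F x = 0%R -> x = 0%R.
  have [c <-] := colim_mon_spans mN x; rewrite F_lincomb.
  move=> /ker/(_ (fun c => lincomb (colim_mon mN) c = 0%R)); apply.
    exact: lincomb_sub.
  move=> _ [n0 [c0 [g [injg [n0N c00 ->]]]]]; rewrite lincomb_push.
  have n0N' : #|'I_n0| <= N by rewrite card_ord.
  rewrite -[RHS](linear0 (image_in injg n0N')) -c00 lincomb_linear.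
  by apply: eq_bigr => u _; rewrite /= (colim_mon_act mN n0N').
have FB x y : F (x - y)%R = (F x - F y)%R by exact: linearB.
have F_inj : injective F.
  move=> x y Fxy; apply/eqP; rewrite -subr_eq0; apply/eqP/F_ker.
  by rewrite FB Fxy subrr.
have F_surj v : exists x, F x = v.
  have /(_ (fun w => exists x, F x = w)) := span_eval v; apply.
    split=> [|a _ _ [x <-] [y <-]]; first by exists 0%R; exact: linear0.
    by exists (a *: x + y)%R; exact: linearP.
  by move=> _ [u ->]; exists (colim_mon mN u); exact: colim_map_mon.
have [G GP] := choice F_surj.
by exists G => // x; exact/F_inj/GP.
Qed.

End Presentation.

Theorem theoremC (R : comPzRingType) (V : fi_module R) :
  noetherian R -> fi_finitely_generated V ->
  exists N : nat, forall n : nat, bijective (subset_colim_map V N n).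
Proof.
move=> noeth [s sP].
pose m (i : 'I_(size s)) := tag (tnth (in_tuple s) i).
pose gen i : V 'I_(m i) := tagged (tnth (in_tuple s) i).
have spans (W : forall S : finType, V S -> Prop) : is_sub_fi_module W ->
    (forall i, W _ (gen i)) -> forall S v, W S v.
  move=> sW gW S v; apply: contrapT => nWv; apply: sP; exists W.
  split=> [|x /(tnthP (in_tuple s))[i ->]]; last exact: gW.
  by split=> //; exists S, v.
have [B BP] := kernel_bounded gen noeth.
exists (maxn B (\max_i m i)); apply: (subset_colim_bij spans) => [i|n c /BP gc].
  by rewrite leq_max leq_bigmax orbT.
move=> W sW XW; apply: gc => // c' [n0 [c0 [g [injg [n0B c00 ->]]]]].
by apply: XW; exists n0, c0, g, injg; rewrite leq_max n0B.
Qed.
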